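(* Let $p$ be an odd prime. Let $d$ be any exponent of the form $$d = 1+p^{i_2}+\cdots+p^{i_p},\qquad 0\le i_2\le\cdots\le i_p,\qquad (i_2,\dots,i_p)\neq(0,\dots,0).$$ Then $d$ is a $p$-exceptional exponent, i.e. $x\mapsto x^d$ is a GAPN function on infinitely many extension fields $\mathbb{F}_{p^n}$ of $\mathbb{F}_p$.
   Context: A function $f\colon \mathbb{F}_{p^n}\to\mathbb{F}_{p^n}$ is a generalized almost perfect nonlinear (GAPN) function if for all $a\in \mathbb{F}_{p^n}^\times$ and $b\in \mathbb{F}_{p^n}$, $$\#\Big\{x\in \mathbb{F}_{p^n} : \sum_{i\in\mathbb{F}_p} f(x+ia)=b\Big\}\le p.$$ An exponent $d$ is called $p$-exceptional if $f(x)=x^d$ is a GAPN function on infinitely many (finite) extension fields of $\mathbb{F}_p$. *)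

(* Defs.v *)
From HB Require Import structures.
From mathcomp Require Import all_boot all_order all_algebra all_field.

Set Implicit Arguments.
Unset Strict Implicit.
Unset Printing Implicit Defensive.

Import GRing.Theory.
Local Open Scope ring_scope.

(* Meant for a field F of characteristic p: the embedding of 'F_p into F is
   then i |-> i%:R, on the representative 0 <= i < p. *)
Definition gapn (p : nat) (F : finFieldType) (f : F -> F) : Prop :=
  forall a b : F, a != 0 ->
    (#|[set x : F | (\sum_(i : 'F_p) f (x + (i : nat)%:R * a))%R == b]| <= p)%N.

(* A finite extension of F_p is, up to isomorphism, determined by its
   cardinality p ^ n; infinitely many extensions thus means unboundedly
   large n. *)
Definition exceptional_exponent (p d : nat) : Prop :=
  forall m : nat, exists2 n : nat, (m < n)%N &
    exists2 F : finFieldType, #|F| = (p ^ n)%N &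
      gapn p (fun x : F => x ^+ d).

(* Main.v *)
Require Import Defs.
From HB Require Import structures.
From mathcomp Require Import all_boot all_order all_algebra all_field.

(** Write [d] as a sum of [p] powers [p ^ k], [k] in a list [s].  Scaling by [a]
    reduces to [a = 1].  Since [(y + i) ^ d] is the product of the [y ^ (p ^ k) + i],
    a monic polynomial of degree [p] in [i], and since the power sums over ['F_p]
    of exponent [0 <= j <= p] vanish except for [j = p - 1], the sum over [i] of
    [(y + i) ^ d] is [- Q y], with [Q] the additive polynomial
    [\sum_(k <- s) 'X^(p ^ k)].  It is nonzero, because its coefficient in degree
    1 counts the zeros of [s], a number between 1 and [p - 1].  Its roots in the
    field with [p ^ n] elements are permuted by the Frobenius map, whose orbits have
    length 1 or [n] if [n] is prime.  As soon as [n] exceeds the degree of [Q], all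
    roots are therefore fixed, and there are at most [p] of them. *)

Set Implicit Arguments.
Unset Strict Implicit.
Unset Printing Implicit Defensive.

Import GRing.Theory.

Section PowerSums.

Local Open Scope ring_scope.

(** By Bezout [km * m = kn * n + 1] for some [km], [kn], and iterating [f] that many times on [x]
    gives both [x] and [f x]. *)
Lemma iter_fixed_coprime (T : Type) (f : T -> T) (m n : nat) (x : T) :
  (0 < m)%N -> coprime m n -> iter m f x = x -> iter n f x = x -> f x = x.
Proof.
move=> m_gt0 /eqP co_mn fm fn.
have fixM k l : iter l f x = x -> iter (k * l) f x = x.
  by move=> fl; elim: k => // k IHk; rewrite mulSn iterD IHk.
case: (egcdnP n m_gt0) => km kn def_km _.
by rewrite -{2}(fixM km m fm) def_km co_mn addn1 iterS fixM.
Qed.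

Lemma root_Frobenius_fixed (F : finFieldType) (p n : nat) (Q : {poly F}) (y : F) :
    prime p -> prime n -> #|F| = (p ^ n)%N -> Q != 0 -> (size Q <= n)%N ->
    (forall z, root Q z -> root Q (z ^+ p)) -> root Q y ->
  y ^+ p = y.
Proof.
move=> p_pr n_pr cardF Q_neq0 szQ Q_stable Qy.
have pcharF := card_finPcharP cardF p_pr.
pose f (x : F) := x ^+ p.
have f_inj : injective f := fmorph_inj (pFrobenius_aut pcharF).
have iter_f k x : iter k f x = x ^+ (p ^ k).
  by elim: k => //= k ->; rewrite /f -exprM expnSr.
(* The orbit of [y] consists of distinct roots of [Q], so it has fewer than [size Q] elements. *)
have lt_order : (order f y < n)%N.
  rewrite -size_orbit; apply: leq_trans szQ.
  apply: (max_poly_roots Q_neq0 _ (orbit_uniq f y)).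
  apply/allP=> z /trajectP[k _ ->].
  by elim: k => //= k; apply: Q_stable.
have co_n : coprime (order f y) n.
  by rewrite coprime_sym prime_coprime // gtnNdvd // order_gt0.
apply: (iter_fixed_coprime (order_gt0 f y) co_n (iter_order f_inj y)).
by rewrite iter_f -cardF expf_card.
Qed.

(** Scaling by a nonzero [c] permutes [F] and multiplies the sum by [c ^+ j]; it remains to find [c]
    with [c ^+ j] not 1. *)
Lemma sum_expf_eq0 (F : finFieldType) (j : nat) :
  (0 < j < #|F|.-1)%N -> \sum_(x : F) x ^+ j = 0.
Proof.
case/andP=> j_gt0 lt_j.
(* Otherwise ['X^j - 1] would vanish at all nonzero elements, more than its degree allows. *)
have [c c_neq0 cj_neq1] : exists2 c : F, c != 0 & c ^+ j != 1.
  apply/exists_inP; apply: contraLR lt_j; rewrite negb_exists_in -leqNgt.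
  move/forall_inP=> all_roots.
  have P_neq0 : 'X^j - 1%:P != 0 :> {poly F} by rewrite -size_poly_eq0 size_XnsubC.
  have := max_poly_roots P_neq0 _ (enum_uniq [pred x : F | x != 0]).
  rewrite size_XnsubC // ltnS -cardE.
  have -> : #|[pred x : F | x != 0]| = #|F|.-1.
    by rewrite -(cardC1 (0 : F)); apply: eq_card => x; rewrite !inE.
  apply; apply/allP=> x; rewrite mem_enum inE => /all_roots.
  by rewrite negbK rootE !hornerE subr_eq0.
have scaleS : c ^+ j * (\sum_(x : F) x ^+ j) = \sum_(x : F) x ^+ j.
  rewrite [RHS](reindex_inj (mulfI c_neq0)) mulr_sumr /=.
  by apply: eq_bigr => x _; rewrite exprMn.
apply/eqP; have /eqP := scaleS.
by rewrite -subr_eq0 -{2}[\sum_(x : F) _]mul1r -mulrBl mulf_eq0 subr_eq0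
  (negPf cj_neq1).
Qed.

Lemma sum_expf_card_pred (F : finFieldType) :
  \sum_(x : F) x ^+ #|F|.-1 = #|F|.-1%:R.
Proof.
have q_gt1 := finNzRing_gt1 F.
rewrite (bigD1 0) //= expr0n -subn1 subn_eq0 leqNgt q_gt1 add0r.
rewrite (eq_bigr (fun=> 1)) => [|x x_neq0]; last first.
  by apply: (mulfI x_neq0); rewrite -exprS subn1 prednK ?mulr1 ?expf_card // ltnW.
by rewrite (sumr_const (predC1 (0 : F))) cardC1 subn1.
Qed.

Lemma sum_horner_Fp (p : nat) (R : comNzRingType) (r : {poly R}) :
    prime p -> odd p -> p \in [pchar R] -> (size r <= p.+1)%N ->
  \sum_(i : 'F_p) r.[(i : nat)%:R] = - r`_p.-1.
Proof.
move=> p_pr p_odd pcharR szr.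
have p_gt2 : (2 < p)%N by rewrite odd_prime_gt2.
(* Power sums are computed in ['F_p] and carried to [R], where a natural number only counts modulo
   [p]. *)
have power_sum j :
    \sum_(i : 'F_p) (i : nat)%:R ^+ j =
      (nat_of_ord (\sum_(i : 'F_p) i ^+ j)%R)%:R :> R.
  transitivity ((\sum_(i : 'F_p) (i : nat) ^ j)%N%:R : R).
    by rewrite natr_sum; apply: eq_bigr => i _; rewrite natrX.
  rewrite -(GRing.natr_mod_pchar pcharR) -val_Fp_nat // natr_sum.
  congr (nat_of_ord _)%:R; apply: eq_bigr => i _.
  by rewrite natrX natr_Zp.
under eq_bigr do rewrite (horner_coef_wide _ szr).
rewrite exchange_big /=; under eq_bigr do rewrite -mulr_sumr power_sum.
have p1_lt : (p.-1 < p.+1)%N by rewrite prednK ?prime_gt0.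
rewrite (bigD1 (Ordinal p1_lt)) //= [X in _ + X]big1 => [|j]; last first.
  rewrite -val_eqE /= => j_neq; have := ltn_ord j; rewrite ltnS leq_eqVlt.
  case: (posnP j) => [-> _ | j_gt0].
    (* All [p] terms equal 1, the one at [i = 0] included. *)
    rewrite (eq_bigr (fun=> 1)) => [|i _]; last by rewrite expr0.
    by rewrite sumr_const card_Fp // pchar_Fp_0 // mulr0.
  case/predU1P=> [-> | lt_jp].
    (* Here [i ^+ p = i] reduces the exponent to 1, and [1 < p - 1] because [p] is odd. *)
    rewrite (eq_bigr (fun i : 'F_p => i ^+ 1)) => [|i _].
      by rewrite sum_expf_eq0 ?mulr0 // card_Fp // ltn_predRL p_gt2.
    by have := expf_card i; rewrite card_Fp.
  rewrite sum_expf_eq0 ?mulr0 // card_Fp // j_gt0 ltn_neqAle j_neq.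
  by rewrite -ltnS prednK ?prime_gt0.
have := sum_expf_card_pred 'F_p; rewrite card_Fp // => ->.
rewrite val_Fp_nat // (GRing.natr_mod_pchar pcharR) -subn1 natrB ?prime_gt0 //.
by rewrite (pcharf0 pcharR) sub0r mulrN1 addr0.
Qed.

Lemma sum_expr_shift_Fp (p : nat) (R : comNzRingType) (s : seq nat) (y : R) :
    prime p -> odd p -> p \in [pchar R] -> size s = p ->
  \sum_(i : 'F_p) (y + (i : nat)%:R) ^+ (\sum_(k <- s) p ^ k)%N
    = - \sum_(k <- s) y ^+ (p ^ k).
Proof.
move=> p_pr p_odd pcharR szs.
(* These are the roots, in the variable [i], of the product of the [y ^+ (p ^ k) + i]; its
   coefficient in degree [p - 1] is minus their sum. *)
pose z := [seq - y ^+ (p ^ k) | k <- s].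
have szz : size z = p by rewrite size_map.
transitivity (\sum_(i : 'F_p) (\prod_(u <- z) ('X - u%:P)).[(i : nat)%:R]).
  apply: eq_bigr => i _; rewrite horner_prod big_map expr_sum.
  apply: eq_bigr => k _; rewrite !hornerE opprK addrC.
  have pX_nat : [pchar R].-nat (p ^ k)%N by rewrite pnatX (pnatE _ p_pr) pcharR.
  rewrite exprDn_pchar //; congr (_ + _).
  (* The Frobenius map fixes the image of each natural number. *)
  elim: k {pX_nat} => // k IHk; rewrite expnSr exprM IHk.
  by rewrite -(pFrobenius_autE pcharR) pFrobenius_aut_nat.
have szz_neq0 : size z != 0%N by rewrite szz -lt0n prime_gt0.
have := coefPn_prod_XsubC szz_neq0; rewrite szz => coefz.
by rewrite sum_horner_Fp ?size_prod_XsubC ?szz // coefz big_map sumrN opprK.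
Qed.

(** The number of zeros in [s] enters as a coefficient of [Q] in [F], hence the condition modulo
    [p]. *)
Lemma gapn_sum_exp (p n : nat) (F : finFieldType) (s : seq nat) :
    prime p -> odd p -> prime n -> #|F| = (p ^ n)%N -> size s = p ->
    ~~ (p %| count_mem 0%N s)%N -> (\sum_(k <- s) p ^ k < n)%N ->
  gapn p (fun x : F => x ^+ (\sum_(k <- s) p ^ k)%N).
Proof.
move=> p_pr p_odd n_pr cardF szs count0 lt_dn a b a_neq0.
have pcharF := card_finPcharP cardF p_pr.
set d := (\sum_(k <- s) p ^ k)%N in lt_dn *.
pose Q : {poly F} := \sum_(k <- s) 'X^(p ^ k).
have hornerQ y : Q.[y] = \sum_(k <- s) y ^+ (p ^ k).
  by rewrite horner_sum; apply: eq_bigr => k _; rewrite hornerXn.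
have FrobQ (y : F) : Q.[y ^+ p] = Q.[y] ^+ p.
  rewrite !hornerQ -(pFrobenius_autE pcharF) rmorph_sum; apply: eq_bigr => k _.
  by rewrite /= pFrobenius_autE -!exprM mulnC.
have pX_nat k : [pchar F].-nat (p ^ k)%N by rewrite pnatX (pnatE _ p_pr) pcharF.
have subQ : {morph (fun y => Q.[y]) : y z / y - z}.
  move=> y z; rewrite !hornerQ -sumrB; apply: eq_bigr => k _.
  by rewrite exprDn_pchar // exprNn_pchar.
have Q_neq0 : Q != 0.
  apply: contra count0 => /eqP Q0; rewrite (dvdn_pcharf pcharF).
  have /eqP : Q`_1 = 0 by rewrite Q0 coef0.
  rewrite coef_sum -sum1_count natr_sum [X in _ -> X == 0]big_mkcond /=.
  congr (_ == 0); apply: eq_bigr => k _; rewrite coefXn.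
  by rewrite -{1}(expn0 p) eqn_exp2l ?prime_gt1 // eq_sym; case: eqP.
have szQ : (size Q <= n)%N.
  apply: leq_trans lt_dn; rewrite /Q /d; elim/big_rec2: _ => [|k q m _ IH].
    by rewrite size_poly0.
  rewrite (leq_trans (size_polyD _ _)) // geq_max size_polyXn ltnS leq_addr /=.
  by rewrite (leq_trans IH) // ltnS leq_addl.
have Q_roots y : Q.[y] = 0 -> y ^+ p = y.
  move=> Qy; apply: (root_Frobenius_fixed p_pr n_pr cardF Q_neq0 szQ); last exact/rootP.
  by move=> z /rootP Qz; apply/rootP; rewrite FrobQ Qz expr0n gtn_eqF ?prime_gt0.
have sumE x : \sum_(i : 'F_p) (x + (i : nat)%:R * a) ^+ d = - (a ^+ d * Q.[x / a]).
  rewrite hornerQ -mulrN -sum_expr_shift_Fp // mulr_sumr.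
  apply: eq_bigr => i _; rewrite -exprMn mulrDr [a * (x / a)]mulrC divfK //.
  by rewrite [a * _]mulrC.
case: (set_0Vmem [set x : F | \sum_(i : 'F_p) (x + (i : nat)%:R * a) ^+ d == b]).
  by move->; rewrite cards0.
set S := [set x | _]; case=> x0; rewrite inE sumE => /eqP x0b.
(* Any solution differs from [x0] by [a] times a root of [Q], so [g] embeds [S] into the roots of
   ['X^p - 'X]. *)
pose g x := (x - x0) / a.
have g_inj : injective g by move=> x y /(divIf a_neq0) /addIr.
have szP : size ('X^p - 'X : {poly F}) = p.+1.
  by rewrite size_polyDl ?size_polyXn // size_polyN size_polyX ltnS prime_gt1.
have P_neq0 : 'X^p - 'X != 0 :> {poly F} by rewrite -size_poly_eq0 szP.
have gS_uniq : uniq [seq g x | x <- enum S] by rewrite (map_inj_uniq g_inj) enum_uniq.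
have := max_poly_roots P_neq0 _ gS_uniq.
rewrite szP ltnS size_map -cardE; apply.
apply/allP=> z /mapP[x]; rewrite mem_enum inE sumE => /eqP xb ->.
rewrite rootE !hornerE subr_eq0; apply/eqP/Q_roots.
rewrite /g mulrBl subQ; apply/eqP; rewrite subr_eq0.
have ad_neq0 : a ^+ d != 0 by rewrite expf_neq0.
by apply/eqP/(mulfI ad_neq0)/oppr_inj; rewrite xb x0b.
Qed.

End PowerSums.

Theorem proposition2p3 (p : nat) (p_prime : prime p) (p_odd : odd p)
    (e : p.-1.-tuple nat) (e_sorted : sorted leq e)
    (e_neq0 : e <> nseq_tuple p.-1 0) (d : nat)
    (d_def : d = 1 + \sum_(j < p.-1) p ^ tnth e j) :
  exceptional_exponent p d.
Proof.
(* The summand 1 of [d] is [p ^ 0], which puts a zero at the head of [s]. *)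
pose s := 0 :: e.
have szs : size s = p by rewrite /= size_tuple prednK ?prime_gt0.
have dE : d = \sum_(k <- s) p ^ k.
  by rewrite big_cons expn0 d_def big_tuple.
have count0 : ~~ (p %| count_mem 0 s).
  have lt_count : count_mem 0 s < p.
    rewrite -[X in _ < X]szs ltnS ltn_neqAle count_size andbT -all_count.
    apply: contra_notN e_neq0 => /all_pred1P e0; apply: val_inj.
    by rewrite /= {1}e0 size_tuple.
  by rewrite gtnNdvd.
(* Exceeding [m] makes the fields unboundedly large; exceeding [d] makes [n] exceed the degree of
   [Q]. *)
move=> m; have [n lt_n n_pr] := prime_above (maxn m d).
move: lt_n; rewrite gtn_max => /andP[lt_mn lt_dn].
have [F _ cardF] := pPrimePowerField p_prime (prime_gt0 n_pr).
exists n => //; exists F => //; rewrite dE in lt_dn *.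
exact: gapn_sum_exp p_odd n_pr cardF szs count0 lt_dn.
Qed.
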